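(* The unit group $U(\mathcal{R}(S_6))$ of the complex representation ring $\mathcal{R}(S_6)$ of the symmetric group $S_6$ is isomorphic to the Klein four-group.
   Context: For a finite group $G$ with irreducible complex representations $V_1,\dots,V_s$ (up to isomorphism), the representation ring $\mathcal{R}(G)$ is the unital commutative ring with $\mathbb{Z}$-basis $[V_1],\dots,[V_s]$ whose operations are determined by $[M]+[N]=[M\oplus N]$ and $[M]\cdot[N]=[M\otimes N]$ for finite-dimensional complex representations $M,N$ of $G$, where $[M]$ is the isomorphism class of $M$. $U(R)$ denotes the group of invertible elements of a ring $R$. *)

(* Defs.v *)
(* MathComp, with excluded middle and choice from mathcomp.classical.boolp. *)
From HB Require Import structures.
From mathcomp Require Import all_boot all_order all_algebra all_fingroup.
From mathcomp Require Import all_solvable all_field all_character.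
From mathcomp Require Import generic_quotient ring boolp.

Set Implicit Arguments.
Unset Strict Implicit.
Unset Printing Implicit Defensive.

Import Order.TTheory GRing.Theory Num.Theory.

Local Open Scope ring_scope.
Local Open Scope quotient_scope.

(* Matrix representations over an algebraically closed field with a norm
   (hence of characteristic 0); isomorphism of representations is mx_rsim. *)
Section Characters.

Variables (C : numClosedFieldType) (gT : finGroupType) (G : {group gT}).
Local Notation rep := (representation C G).

Lemma triv_mx_repr : mx_repr G (fun _ : gT => 1%:M : 'M[C]_1).
Proof. by split=> // g h Gg Gh; rewrite mulmx1. Qed.

Definition triv_grepr : rep := Representation (MxRepresentation triv_mx_repr).

Definition prod_grepr (M N : rep) : rep := Representation (prod_repr M N).

(* Cut off outside G, where a matrix representation of G is unconstrained. *)
Definition rchar (M : rep) : {ffun gT -> C} := [ffun x => \tr (M x) *+ (x \in G)].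

Lemma rchar0 : rchar grepr0 = 0.
Proof. by apply/ffunP=> x; rewrite !ffunE mxtrace1 mul0rn. Qed.

Lemma rchar_triv x : rchar triv_grepr x = (x \in G)%:R.
Proof. by rewrite ffunE mxtrace1. Qed.

Lemma rchar_dadd M N : rchar (dadd_grepr M N) = rchar M + rchar N.
Proof. by apply/ffunP=> x; rewrite !ffunE mxtrace_block mulrnDl. Qed.

Lemma rchar_prod M N x : rchar (prod_grepr M N) x = rchar M x * rchar N x.
Proof.
by rewrite !ffunE mxtrace_prod; case: (x \in G); rewrite ?mulr1n ?mulr0n ?mulr0.
Qed.

Lemma rchar_dsum I r (P : pred I) (M : I -> rep) :
  rchar (\big[dadd_grepr/grepr0]_(i <- r | P i) M i) =
    \sum_(i <- r | P i) rchar (M i).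
Proof. exact: (big_morph _ rchar_dadd rchar0). Qed.

Lemma rchar_muln M k : rchar (muln_grepr M k) = rchar M *+ k.
Proof. by rewrite rchar_dsum sumr_const card_ord. Qed.

Lemma rchar_sim (M N : rep) : mx_rsim M N -> rchar M = rchar N.
Proof.
case/mx_rsim_def=> f12 [f21] fK defM; apply/ffunP=> x; rewrite !ffunE.
have [Gx | //] := boolP (x \in G); congr (_ *+ _).
by rewrite defM // mxtrace_mulC mulmxA fK mul1mx.
Qed.

Let C'G : [pchar C]^'.-group%g G.
Proof. by apply/pgroupP=> p _; rewrite inE /= pchar_num. Qed.

Section Standard.

Variable iG : irrType C G.
Local Notation irr_grepr := (fun i : iG => Representation (irr_repr i)).

Lemma rsim_standard n (rG : mx_representation C G n) :
  exists m : iG -> nat,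
    mx_rsim rG (\big[dadd_grepr/grepr0]_i muln_grepr (irr_grepr i) (m i)).
Proof.
pose sG := DecSocleType rG.
pose irrc (W : sG) : iG := irr_comp iG (socle_repr W).
pose soc i := [pick W | irrc W == i].
exists (fun i => oapp (fun W => socle_mult W) 0%N (soc i)).
pose W i := oapp val 0 (soc i); pose S := (\sum_i W i)%MS.
have [defS dxS]: (S :=: 1%:M)%MS /\ mxdirect S.
  rewrite /S mxdirectE /= !(bigID soc xpredT) /=.
  rewrite addsmxC big1 => [|i]; last by rewrite /W; case (soc i).
  rewrite adds0mx_id addnC (@big1 nat) ?add0n => [|i]; last first.
    by rewrite /W; case: (soc i); rewrite ?mxrank0.
  have <-: Socle sG = 1%:M := reducible_Socle1 sG (mx_Maschke_pchar rG C'G).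
  have [W0 _ | noW] := pickP (@predT sG); last first.
    suff no_i: (soc : pred iG) =1 xpred0 by rewrite /Socle !big_pred0 ?mxrank0.
    by move=> i; rewrite /soc; case: pickP => // W0; have:= noW W0.
  have irrK Wi: soc (irrc Wi) = Some Wi.
    rewrite /soc; case: pickP => [W' | /(_ Wi)] /= /eqP // eqWi.
    apply/eqP/socle_rsimP.
    apply: mx_rsim_trans
      (rsim_irr_comp_pchar iG C'G (socle_irr _)) (mx_rsim_sym _).
    by rewrite [irr_comp _ _]eqWi; apply: rsim_irr_comp_pchar (socle_irr _).
  have bij_irr: {on [pred i | soc i], bijective irrc}.
    exists (odflt W0 \o soc) => [Wi _ | i]; first by rewrite /= irrK.
    by rewrite inE /soc /=; case: pickP => //= Wi; move/eqP.
  rewrite !(reindex irrc) {bij_irr}//=.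
  have all_soc Wi: soc (irrc Wi) by rewrite irrK.
  rewrite (eq_bigr val) => [|Wi _]; last by rewrite /W irrK.
  rewrite !(eq_bigl _ _ all_soc); split=> //.
  rewrite (eq_bigr (mxrank \o val)) => [|Wi _]; last by rewrite /W irrK.
  by rewrite -mxdirectE /= Socle_direct.
pose modW i : mxmodule rG (W i) :=
  if soc i is Some Wi as oWi return mxmodule rG (oapp val 0 oWi) then
    component_mx_module rG (socle_base Wi)
  else mxmodule0 rG n.
apply: mx_rsim_trans (mx_rsim_sym (rsim_submod1 (mxmodule1 rG) _)) _ => //.
apply: mx_rsim_dsum (modW) _ defS dxS _ => i.
rewrite /W /modW /soc; case: pickP => [Wi|_] /=; last first.
  rewrite /muln_grepr big_ord0.
  by exists 0 => [||x _]; rewrite /row_free ?mxrank0 ?mulmx0 ?mul0mx.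
move/eqP=> <-; apply: mx_rsim_socle.
exact: rsim_irr_comp_pchar (socle_irr Wi).
Qed.

(* Linear extension of f to the group algebra, evaluated at the i-th central
   idempotent. *)
Definition xrchar (i : iG) (f : {ffun gT -> C}) : C :=
  \sum_(k < #|G|) gring_row (Wedderburn_id i) 0 k * f (enum_val k).

Lemma xrchar_is_zmod_morphism i : zmod_morphism (xrchar i).
Proof.
move=> f g; rewrite /xrchar -sumrB.
by apply: eq_bigr => k _; rewrite !ffunE mulrBr.
Qed.

HB.instance Definition _ i :=
  GRing.isZmodMorphism.Build _ _ (xrchar i) (xrchar_is_zmod_morphism i).

Lemma xrchar_repr i (M : rep) : xrchar i (rchar M) = \tr (gring_op M (Wedderburn_id i)).
Proof.
rewrite gring_opE [gring_row _ in RHS]row_sum_delta !linear_sum /xrchar /=.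
apply: eq_bigr => k _; rewrite !linearZ ffunE enum_valP /=.
by congr (_ * \tr _); rewrite /gring_mx /= -rowE rowK mxvecK.
Qed.

Lemma xrchar_irr i j :
  xrchar j (rchar (irr_grepr i)) = (irr_degree i)%:R *+ (i == j).
Proof.
rewrite xrchar_repr /=; have [<- | ne_ij] := eqVneq i j.
  by rewrite op_Wedderburn_id_pchar // mxtrace1.
rewrite (irr_repr'_op0_pchar C'G _ (Wedderburn_id_mem j)) ?mxtrace0 //.
by rewrite eq_sym.
Qed.

Lemma rchar_irr_inj (c d : iG -> int) :
    \sum_i rchar (irr_grepr i) *~ c i = \sum_i rchar (irr_grepr i) *~ d i ->
  c =1 d.
Proof.
have x_sum (e : iG -> int) j :
    xrchar j (\sum_i rchar (irr_grepr i) *~ e i) = (irr_degree j)%:R *~ e j.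
  rewrite raddf_sum (bigD1 j) //= big1 ?addr0 => [|i ne_ij].
    by rewrite raddfMz /= xrchar_irr eqxx.
  by rewrite raddfMz /= xrchar_irr (negPf ne_ij) mul0rz.
move=> eq_cd j; move/(congr1 (xrchar j)): eq_cd; rewrite !x_sum.
by apply: mulrIz; rewrite pnatr_eq0 -lt0n irr_degree_gt0.
Qed.

Lemma rchar_standard (M : rep) : exists m : iG -> nat,
  mx_rsim M (\big[dadd_grepr/grepr0]_i muln_grepr (irr_grepr i) (m i))
  /\ rchar M = \sum_i rchar (irr_grepr i) *+ m i.
Proof.
have [m simM] := rsim_standard M; exists m; split=> //.
rewrite (rchar_sim (N := \big[_/_]_i _) simM) rchar_dsum.
by apply: eq_bigr => i _; rewrite rchar_muln.
Qed.

End Standard.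

Lemma rchar_inj (M N : rep) : rchar M = rchar N -> mx_rsim M N.
Proof.
pose iG : irrType C G := DecSocleType _.
have [m [simM ->]] := rchar_standard iG M.
have [m' [simN ->]] := rchar_standard iG N.
move/(@rchar_irr_inj iG m m') => eq_m.
apply: mx_rsim_trans simM (mx_rsim_sym _).
rewrite (eq_bigr (fun i => muln_grepr (Representation (irr_repr i)) (m' i))) //.
by move=> i _; have [->] := eq_m i.
Qed.

Lemma rcharP (M N : rep) : rchar M = rchar N <-> mx_rsim M N.
Proof. by split; [exact: rchar_inj | exact: rchar_sim]. Qed.

End Characters.

HB.instance Definition _ (C : numClosedFieldType) (gT : finGroupType)
  (G : {group gT}) := gen_eqMixin (representation C G).
HB.instance Definition _ (C : numClosedFieldType) (gT : finGroupType)
  (G : {group gT}) := gen_choiceMixin (representation C G).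

(* The representation ring is the Grothendieck ring of the semiring of
   isomorphism classes of representations: the pair (M, N) stands for
   [M] - [N].  Cancellation of direct summands makes this an equivalence
   without a stabilizing summand. *)
Section RepresentationRing.

Variables (C : numClosedFieldType) (gT : finGroupType) (G : {group gT}).
Local Notation rep := (representation C G).

Definition vrep_eq (p q : rep * rep) : bool :=
  `[< mx_rsim (dadd_grepr p.1 q.2) (dadd_grepr q.1 p.2) >].

Definition vchar (p : rep * rep) := rchar p.1 - rchar p.2.

Lemma vrep_eqE p q : vrep_eq p q = (vchar p == vchar q).
Proof.
rewrite /vchar subr_eq addrAC eq_sym subr_eq eq_sym -!rchar_dadd.
by apply/asboolP/eqP; [apply: rchar_sim | apply: rchar_inj].
Qed.

Lemma vrep_eq_refl : reflexive vrep_eq.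
Proof. by move=> p; rewrite vrep_eqE. Qed.
Lemma vrep_eq_sym : symmetric vrep_eq.
Proof. by move=> p q; rewrite !vrep_eqE eq_sym. Qed.
Lemma vrep_eq_trans : transitive vrep_eq.
Proof. by move=> p q r; rewrite !vrep_eqE => /eqP->. Qed.

Canonical vrep_equiv :=
  EquivRel vrep_eq vrep_eq_refl vrep_eq_sym vrep_eq_trans.

Definition repr_ring := {eq_quot vrep_eq}.

HB.instance Definition _ := Choice.on repr_ring.
HB.instance Definition _ := EqQuotient.on repr_ring.

Definition grepr_class (M : rep) : repr_ring := \pi_repr_ring (M, grepr0).

Definition vadd (p q : rep * rep) :=
  (dadd_grepr p.1 q.1, dadd_grepr p.2 q.2).
Definition vopp (p : rep * rep) := (p.2, p.1).
Definition vmul (p q : rep * rep) :=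
  (dadd_grepr (prod_grepr p.1 q.1) (prod_grepr p.2 q.2),
   dadd_grepr (prod_grepr p.1 q.2) (prod_grepr p.2 q.1)).

Definition repr_zero : repr_ring := grepr_class grepr0.
Definition repr_one : repr_ring := grepr_class (triv_grepr C G).
Definition repr_opp (x : repr_ring) : repr_ring := \pi_repr_ring (vopp (repr x)).
Definition repr_add (x y : repr_ring) : repr_ring :=
  \pi_repr_ring (vadd (repr x) (repr y)).
Definition repr_mul (x y : repr_ring) : repr_ring :=
  \pi_repr_ring (vmul (repr x) (repr y)).

(* The virtual character of an element. *)
Definition rr_char (x : repr_ring) : {ffun gT -> C} := vchar (repr x).

Lemma rr_char_pi p : rr_char (\pi_repr_ring p) = vchar p.
Proof.
apply/eqP; rewrite -vrep_eqE; suff: \pi_repr_ring (repr (\pi_repr_ring p)) == \pi_repr_ring p.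
  by rewrite eqmodE.
by rewrite reprK.
Qed.

Lemma rr_char_inj : injective rr_char.
Proof.
move=> x y /eqP; rewrite /rr_char -vrep_eqE => eq_xy.
by rewrite -[x]reprK -[y]reprK; apply/eqP; rewrite eqmodE.
Qed.

Lemma rr_char_class M : rr_char (grepr_class M) = rchar M.
Proof. by rewrite rr_char_pi /vchar rchar0 subr0. Qed.

Lemma rr_char_out x g : g \notin G -> rr_char x g = 0.
Proof. by move=> /negPf G'g; rewrite !ffunE G'g subr0. Qed.

Lemma rr_char0 : rr_char repr_zero = 0.
Proof. by rewrite rr_char_class rchar0. Qed.

Lemma rr_char1 g : rr_char repr_one g = (g \in G)%:R.
Proof. by rewrite rr_char_class rchar_triv. Qed.

Lemma rr_charN x : rr_char (repr_opp x) = - rr_char x.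
Proof. by rewrite rr_char_pi /vchar opprB. Qed.

Lemma rr_charD x y : rr_char (repr_add x y) = rr_char x + rr_char y.
Proof. by rewrite rr_char_pi /vchar !rchar_dadd opprD addrACA. Qed.

Lemma rr_charM x y g : rr_char (repr_mul x y) g = rr_char x g * rr_char y g.
Proof.
rewrite rr_char_pi /rr_char /vchar /= !rchar_dadd.
have addE (a b : {ffun gT -> C}) : (a + b) g = a g + b g by rewrite ffunE.
have oppE (a : {ffun gT -> C}) : (- a) g = - a g by rewrite ffunE.
by rewrite !(addE, oppE, rchar_prod); ring.
Qed.

Lemma repr_addA : associative repr_add.
Proof. by move=> x y z; apply: rr_char_inj; rewrite !rr_charD addrA. Qed.
Lemma repr_addC : commutative repr_add.
Proof. by move=> x y; apply: rr_char_inj; rewrite !rr_charD addrC. Qed.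
Lemma repr_add0 : left_id repr_zero repr_add.
Proof. by move=> x; apply: rr_char_inj; rewrite rr_charD rr_char0 add0r. Qed.
Lemma repr_addN : left_inverse repr_zero repr_opp repr_add.
Proof.
by move=> x; apply: rr_char_inj; rewrite rr_charD rr_charN rr_char0 addNr.
Qed.

HB.instance Definition _ :=
  GRing.isZmodule.Build repr_ring repr_addA repr_addC repr_add0 repr_addN.

Lemma repr_mulA : associative repr_mul.
Proof.
by move=> x y z; apply/rr_char_inj/ffunP=> g; rewrite !rr_charM mulrA.
Qed.
Lemma repr_mulC : commutative repr_mul.
Proof.
by move=> x y; apply/rr_char_inj/ffunP=> g; rewrite !rr_charM mulrC.
Qed.
Lemma repr_mul1 : left_id repr_one repr_mul.
Proof.
move=> x; apply/rr_char_inj/ffunP=> g; rewrite rr_charM rr_char1.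
by have [Gg | G'g] := boolP (g \in G); rewrite ?mul1r // rr_char_out ?mulr0.
Qed.
Lemma repr_mulDl : left_distributive repr_mul repr_add.
Proof.
move=> x y z; apply/rr_char_inj/ffunP=> g.
have addE (a b : {ffun gT -> C}) : (a + b) g = a g + b g by rewrite ffunE.
by rewrite rr_charM !rr_charD (addE (rr_char x)) (addE (rr_char _)) !rr_charM mulrDl.
Qed.
Lemma repr_one_neq0 : repr_one != repr_zero.
Proof.
apply/eqP=> /(congr1 (fun x => rr_char x 1%g)) /eqP.
by rewrite rr_char1 rr_char0 group1 ffunE oner_eq0.
Qed.

HB.instance Definition _ := GRing.Zmodule_isComNzRing.Build repr_ring
  repr_mulA repr_mulC repr_mul1 repr_mulDl repr_one_neq0.

Definition repr_unit : {pred repr_ring} :=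
  fun x => `[< exists y : repr_ring, y * x = 1 >].

Definition repr_inv (x : repr_ring) : repr_ring :=
  if pselect (exists y : repr_ring, y * x = 1) is left ex
  then projT1 (cid ex) else x.

Lemma repr_mulV : {in repr_unit, left_inverse 1 repr_inv *%R}.
Proof.
by move=> x /asboolP Ux; rewrite /repr_inv; case: pselect => // ex; case: cid.
Qed.
Lemma repr_unitPl (x y : repr_ring) : y * x = 1 -> repr_unit x.
Proof. by move=> yx1; apply/asboolP; exists y. Qed.
Lemma repr_inv_out : {in [predC repr_unit], repr_inv =1 id}.
Proof. by move=> x /asboolP nUx; rewrite /repr_inv; case: pselect. Qed.

HB.instance Definition _ := GRing.ComNzRing_hasMulInverse.Build repr_ring
  repr_mulV repr_unitPl repr_inv_out.

Lemma grepr_classP (M N : rep) : grepr_class M = grepr_class N <-> mx_rsim M N.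
Proof.
rewrite -rcharP -!rr_char_class; split=> [-> // | eqMN].
exact: rr_char_inj.
Qed.

Lemma grepr_classD M N :
  grepr_class M + grepr_class N = grepr_class (dadd_grepr M N).
Proof. by apply: rr_char_inj; rewrite rr_charD !rr_char_class rchar_dadd. Qed.

Lemma grepr_classM M N :
  grepr_class M * grepr_class N = grepr_class (prod_grepr M N).
Proof.
apply/rr_char_inj/ffunP=> g.
by rewrite rr_charM !rr_char_class rchar_prod.
Qed.

Lemma rr_char_is_zmod_morphism : zmod_morphism rr_char.
Proof. by move=> x y; rewrite rr_charD rr_charN. Qed.

HB.instance Definition _ :=
  GRing.isZmodMorphism.Build _ _ rr_char rr_char_is_zmod_morphism.

(* An irrType indexes the irreducible representations up to isomorphism, so
   their classes form a Z-basis. *)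
Lemma grepr_class_basis (iG : irrType C G) (x : repr_ring) :
  exists! c : {ffun iG -> int},
    x = \sum_i grepr_class (Representation (irr_repr i)) *~ c i.
Proof.
have charE (c : {ffun iG -> int}) :
    rr_char (\sum_i grepr_class (Representation (irr_repr i)) *~ c i) =
      \sum_i rchar (Representation (irr_repr i)) *~ c i.
  by rewrite raddf_sum; apply: eq_bigr => i _; rewrite raddfMz /= rr_char_class.
have [m [_ def1]] := rchar_standard iG (repr x).1.
have [n [_ def2]] := rchar_standard iG (repr x).2.
exists [ffun i => (m i)%:Z - (n i)%:Z]; split=> [|c def_x].
  apply: rr_char_inj; rewrite charE /rr_char /vchar def1 def2 -sumrB.
  by apply: eq_bigr => i _; rewrite ffunE mulrzBr.
apply/ffunP; apply: rchar_irr_inj; rewrite -(charE c) -def_x.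
rewrite /rr_char /vchar def1 def2 -sumrB.
by apply: eq_bigr => i _; rewrite ffunE mulrzBr.
Qed.

End RepresentationRing.

Section UnitGroup.

Variable R : comUnitRingType.

Record unit_group := UnitGroup { ugval :> R; _ : ugval \is a GRing.unit }.

HB.instance Definition _ := [isSub for ugval].
HB.instance Definition _ := [Choice of unit_group by <:].

Implicit Types u v : unit_group.

Lemma ug_mul_subproof u v : ugval u * ugval v \is a GRing.unit.
Proof. by rewrite unitrM (valP u) (valP v). Qed.
Lemma ug_inv_subproof u : (ugval u)^-1 \is a GRing.unit.
Proof. by rewrite unitrV (valP u). Qed.

Definition ug_one := UnitGroup (unitr1 R).
Definition ug_mul u v := UnitGroup (ug_mul_subproof u v).
Definition ug_inv u := UnitGroup (ug_inv_subproof u).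

Lemma ug_mulA : associative ug_mul.
Proof. by move=> u v w; apply: val_inj; rewrite /= mulrA. Qed.
Lemma ug_mul1 : left_id ug_one ug_mul.
Proof. by move=> u; apply: val_inj; rewrite /= mul1r. Qed.
Lemma ug_mulV : left_inverse ug_one ug_inv ug_mul.
Proof. by move=> u; apply: val_inj; rewrite /= mulVr ?(valP u). Qed.
Lemma ug_mul1r : right_id ug_one ug_mul.
Proof. by move=> u; apply: val_inj; rewrite /= mulr1. Qed.
Lemma ug_mulVr : right_inverse ug_one ug_inv ug_mul.
Proof. by move=> u; apply: val_inj; rewrite /= mulrV ?(valP u). Qed.

HB.instance Definition _ := isGroup.Build unit_group
  ug_mulA ug_mul1 ug_mul1r ug_mulV ug_mulVr.

End UnitGroup.

(* Main.v *)
Require Import Defs.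
From HB Require Import structures.
From mathcomp Require Import all_boot all_order all_algebra all_fingroup.
From mathcomp Require Import all_solvable all_field all_character generic_quotient.
From mathcomp Require Import complex reals.

Set Implicit Arguments.
Unset Strict Implicit.
Unset Printing Implicit Defensive.

Import Order.TTheory GRing.Theory Num.Theory.

Local Open Scope ring_scope.

(** The values of a unit u of the representation ring R(S_n), n >= 2, are units
of Z.  Indeed, if k is prime to the order of g, then g ^+ k is conjugate to g in
S_n (perm_expg_conj), and a group with this property has integer character
values: averaging over <[g]> shows by induction on the order of g that the
values are rational (rational_mxtrace), and as sums of roots of unity they are
integral over Z (integral_mxtrace).  Since u(g) and u^-1(g) are integers with
product 1, u(g) is 1 or -1.

Write u as the sum of c_i chi_i over the irreducible characters.  As g^-1 is
conjugate to g, Schur orthogonality gives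
sum_i c_i ^ 2 = (1 / |G|) sum_g u(g^-1) u(g) = 1, so u is, up to sign, a single
irreducible character, whose degree is the absolute value of u(1), that is, 1
(unit_rr_char_mul).  The transpositions generate S_n and are all conjugate, so
u is determined by its signs at the identity and at one transposition t
(unit_rr_char_perm).  These two signs define an injective morphism to the Klein
four-group, which is onto: -1 and the sign character have images (1, 1) and
(0, 1). *)

(** * Powers of a permutation prime to its order *)

(** Choose a base point in each orbit of g, and send g^i x0 to g^(k i) x0.  This
is well defined because a power of g that fixes x0 has a k-th power that does,
and it is onto because g is itself a power of g^k; it conjugates g to g^k. *)
Lemma perm_expg_conj (T : finType) (g : {perm T}) k :
  coprime #[g]%g k -> exists h : {perm T}, (g ^ h = g ^+ k)%g.
Proof.
move=> co_gk; pose r := froot g; pose i x := findex g (r x) x.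
pose h x := ((g ^+ k) ^+ i x)%g (r x).
have symg : connect_sym (frel g) by apply: fconnect_sym; apply: perm_inj.
have iK x : (g ^+ i x)%g (r x) = x.
  by rewrite permX iter_findex // symg connect_root.
have well_def j l x : ((g ^+ j) x = (g ^+ l) x ->
    ((g ^+ k) ^+ j) x = ((g ^+ k) ^+ l) x)%g.
  wlog le_jl : j l / (j <= l)%N.
    by move=> IH; case/orP: (leq_total j l) => /IH // eq_lj /esym/eq_lj.
  rewrite -(subnK le_jl) => eq_jl.
  have {eq_jl} fix_x : (g ^+ (l - j))%g x = x.
    by apply: (@perm_inj _ (g ^+ j)%g); rewrite -permM -expgD.
  rewrite expgD permM -[((g ^+ k) ^+ (l - j))%g]expgM (mulnC k) expgM.
  congr (_ _).
  by rewrite permX; elim: {1}k => //= m <-; rewrite fix_x.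
have hE j x : h ((g ^+ j)%g x) = ((g ^+ k) ^+ j)%g (h x).
  have r_gx : r ((g ^+ j)%g x) = r x.
    by rewrite /r; apply/esym/(fingraph.rootP symg); rewrite permX fconnect_iter.
  rewrite /h r_gx -permM -expgD; apply: well_def.
  by rewrite -[in LHS]r_gx iK expgD permM iK.
have [m gkm] : exists m, ((g ^+ k) ^+ m = g)%g.
  have : g \in <[g ^+ k]>%g.
    by move: co_gk; rewrite -generator_coprime => /eqP<-; apply: cycle_id.
  by case/cycleP=> m gE; exists m.
(* On the base points h is the identity, so hE reaches every point of an orbit. *)
have h_surj y : exists x, h x = y.
  exists ((g ^+ (m * i y))%g (r y)); rewrite hE.
  have -> : h (r y) = r y.
    rewrite /h /i; have rr : r (r y) = r y by rewrite /r root_root.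
    by rewrite rr findex0 expg0 perm1.
  by rewrite expgM gkm iK.
have h_inj : injective h.
  apply/injectiveP; rewrite /injectiveb /dinjectiveb.
  apply/card_uniqP.
  rewrite size_map -cardE.
  by apply: eq_card => y; have [x <-] := h_surj y; rewrite codom_f.
exists (perm h_inj); apply/permP=> y; have [x <-] := h_surj y.
have := permJ g (perm h_inj) x; rewrite !permE => ->.
by have := hE 1%N x; rewrite !expg1 => ->.
Qed.

(** For complex representations this condition says that all character values
are rational, whence the usual name. *)
Definition rational_group (gT : finGroupType) (G : {group gT}) :=
  {in G, forall g k, coprime #[g]%g k ->
    exists2 h, h \in G & (g ^ h = g ^+ k)%g}.

Lemma symmetric_rational (T : finType) : rational_group [set: {perm T}]%G.
Proof. by move=> g _ k /perm_expg_conj[h gh]; exists h; rewrite ?inE. Qed.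

(** * Integrality of character values *)

(** If p is monic and p(q) = 0, then by Gauss the factor X - q of p is a rational
multiple a *: p1 of an integer factor p1 of p; the leading coefficient of p1 is
a unit, and so is a. *)
Lemma rat_integral_int (F : numFieldType) (q : rat) :
  integralOver (intr : int -> F) (ratr q) -> exists z : int, q = z%:~R.
Proof.
case=> p p_monic root_q; have : root (map_poly (intr : int -> rat) p) q.
  have eq_intr : (intr : int -> F) =1 ratr \o intr by move=> z; rewrite /= ratr_int.
  by rewrite -(fmorph_root (@ratr F)) -map_poly_comp -(eq_map_poly eq_intr).
rewrite root_factor_theorem => /dvdpP_rat_int[p1 [a a_neq0 def_q] [r def_p]].
have lead1 : lead_coef p1 * lead_coef r = 1.
  by rewrite -lead_coefM -def_p; apply/eqP.
have a_lead : a = (lead_coef r)%:~R.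
  have /eqP := congr1 lead_coef def_q.
  rewrite lead_coefXsubC lead_coefZ lead_coef_map_inj ?rmorph0 //; last exact: intr_inj.
  move/eqP=> /(congr1 ( *%R^~ (lead_coef r)%:~R)).
  by rewrite mul1r -mulrA -intrM lead1 mulr1.
exists (- (lead_coef r * p1`_0)); rewrite rmorphN rmorphM /= -a_lead.
have := congr1 (fun s : {poly rat} => s`_0) def_q.
by rewrite coefB coefX coefC /= sub0r coefZ coef_map /= => <-; rewrite opprK.
Qed.

Section CharacterValues.

Variables (C : numClosedFieldType) (gT : finGroupType) (G : {group gT}).
Variables (n : nat) (rG : mx_representation C G n).

Lemma mxtrace_reprJ : {in G &, forall g h, \tr (rG (g ^ h)%g) = \tr (rG g)}.
Proof.
move=> g h Gg Gh; rewrite conjgE !repr_mxM ?groupM ?groupV //.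
by rewrite mxtrace_mulC -mulmxA -repr_mxM ?groupV // mulgV repr_mx1 mulmx1.
Qed.

(** The sum S of the matrices rG h satisfies S *m S = |H| S.  A factorization
S = L *m U through the rank of S therefore has U *m L = |H|, and the trace of
S is that of U *m L. *)
Lemma sum_mxtrace_subgroup (H : {group gT}) : H \subset G ->
  exists r, \sum_(h in H) \tr (rG h) = (#|H| * r)%:R.
Proof.
move=> sHG; pose S := \sum_(h in H) rG h.
have hS h : h \in H -> rG h *m S = S.
  move=> Hh; rewrite mulmx_sumr [RHS](reindex_inj (mulgI h)) /=.
  by apply: eq_big => x; rewrite ?groupMl // => Hx; rewrite repr_mxM ?(subsetP sHG).
have SS : S *m S = #|H|%:R *: S.
  by rewrite mulmx_suml (eq_bigr (fun=> S)) // sumr_const scaler_nat.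
exists (\rank S); have <- : \tr S = \sum_(h in H) \tr (rG h) by rewrite raddf_sum.
move: (col_base S) (row_base S) (mulmx_base S) (col_base_full S) (row_base_free S).
move=> L U def_S fullL freeU; rewrite -{1}def_S mxtrace_mulC.
suff -> : U *m L = #|H|%:R%:M by rewrite mxtrace_scalar natrM mulr_natr.
apply: (row_full_inj fullL); apply: (row_free_inj freeU) => /=.
by rewrite -scalemx1 -scalemxAr mulmx1 -scalemxAl def_S -SS mulmxA def_S -mulmxA def_S.
Qed.

(** The trace is the sum of the roots of the characteristic polynomial, which are
roots of unity. *)
Lemma integral_mxtrace g :
  g \in G -> integralOver (intr : int -> C) (\tr (rG g)).
Proof.
move=> Gg; have [n0 | n_gt0] := posnP n.
  by move: (rG g); rewrite n0 => A; rewrite [A]flatmx0 mxtrace0; apply: integral0.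
have [r def_r] := closed_field_poly_normal (char_poly (rG g)).
rewrite (eqP (char_poly_monic _)) scale1r in def_r.
have size_r : size r = n.
  by apply/succn_inj; rewrite -(size_char_poly (rG g)) def_r size_prod_XsubC.
have -> : \tr (rG g) = \sum_(z <- r) z.
  apply: oppr_inj; rewrite -char_poly_trace // def_r -size_r coefPn_prod_XsubC //.
  by rewrite size_r -lt0n.
rewrite big_seq; elim/big_ind: _ => [||z rz]; [exact: integral0 | exact: integral_add |].
have /eigenvalueP[v def_v v_neq0] : eigenvalue (rG g) z.
  by rewrite eigenvalue_root_char def_r root_prod_XsubC.
have v_pow k : v *m rG (g ^+ k)%g = z ^+ k *: v.
  elim: k => [|k IHk]; first by rewrite repr_mx1 mulmx1 scale1r.
  by rewrite expgSr repr_mxM ?groupX // mulmxA IHk -scalemxAl def_v scalerA exprSr.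
exists ('X^#[g]%g - 1); first by rewrite monicXnsubC ?order_gt0.
rewrite rmorphB rmorph1 /= map_polyXn /root !hornerE subr_eq0.
have /eqP : (z ^+ #[g]%g - 1) *: v = 0.
  by rewrite scalerBl scale1r -v_pow expg_order repr_mx1 mulmx1 subrr.
by rewrite scaler_eq0 (negPf v_neq0) orbF subr_eq0.
Qed.

Hypothesis ratG : rational_group G.

(** In the sum of the traces over <[g]>, which is an integer, the generators all
contribute the trace of g, and the other elements have smaller order. *)
Lemma rational_mxtrace g : g \in G -> exists q : rat, \tr (rG g) = ratr q.
Proof.
move: {2}_.+1 (ltnSn #[g]%g) => m; elim: m g => // m IHm g; rewrite ltnS => le_g Gg.
have sgG : <[g]>%g \subset G by rewrite cycle_subG.
have [r sum_g] := sum_mxtrace_subgroup sgG.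
have gen_tr h : (h \in <[g]>%g) && generator <[g]>%g h -> \tr (rG h) = \tr (rG g).
  case/andP=> /cycleP[k ->]; rewrite generator_coprime => /(ratG Gg)[x Gx <-].
  exact: mxtrace_reprJ.
rewrite (bigID (generator <[g]>%g)) /= (eq_bigr _ gen_tr) sumr_const in sum_g.
have [q sum_q] : exists q : rat,
    \sum_(h in <[g]>%g | ~~ generator <[g]>%g h) \tr (rG h) = ratr q.
  elim/big_ind: _ => [|x y [p ->] [q ->]|h /andP[gh not_gen]].
  - by exists 0; rewrite rmorph0.
  - by exists (p + q); rewrite rmorphD.
  apply: IHm; last exact: subsetP gh.
  apply: leq_trans le_g; rewrite proper_card // properEneq cycle_subG gh andbT.
  by rewrite eq_sym.
move: sum_g; set N := #|_|; rewrite sum_q => sum_g.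
have N_neq0 : N%:R != 0 :> C.
  rewrite pnatr_eq0 -lt0n; apply/card_gt0P; exists g.
  by rewrite unfold_in /= cycle_id /generator eqxx.
exists (((#|<[g]>%g| * r)%:R - q) / N%:R).
by rewrite fmorph_div rmorphB /= !ratr_nat -sum_g addrK -(mulr_natr (\tr _)) mulfK.
Qed.

Lemma int_mxtrace g : g \in G -> exists z : int, \tr (rG g) = z%:~R.
Proof.
move=> Gg; have [q tr_q] := rational_mxtrace Gg.
have := integral_mxtrace Gg; rewrite tr_q => /rat_integral_int[z ->].
by exists z; rewrite ratr_int.
Qed.

End CharacterValues.

(** * Schur orthogonality *)

Section SchurOrthogonality.

Variables (C : numClosedFieldType) (gT : finGroupType) (G : {group gT}).

(** Schur: the kernel and the image of f are submodules. *)
Lemma intertwiner_irr_rsim m n (rS : mx_representation C G m)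
    (rT : mx_representation C G n) (f : 'M[C]_(m, n)) :
  mx_irreducible rS -> mx_irreducible rT ->
  {in G, forall x, rS x *m f = f *m rT x} -> f != 0 -> mx_rsim rS rT.
Proof.
move=> /mx_irrP[_ irrS] /mx_irrP[_ irrT] hom_f f_neq0.
have ker_mod : mxmodule rS (kermx f).
  apply/mxmoduleP=> x Gx; apply/sub_kermxP.
  by rewrite -mulmxA hom_f // mulmxA mulmx_ker mul0mx.
have free_f : row_free f.
  rewrite -kermx_eq0; apply: contraNT f_neq0 => /(irrS _ ker_mod) full_ker.
  by apply/eqP/(row_full_inj full_ker); rewrite /= mulmx_ker mulmx0.
have full_f : row_full f.
  have := irrT <<f>>%MS; rewrite /row_full !genmxE; apply.
    apply/mxmoduleP=> x Gx; rewrite (eqmxMr _ (genmxE f)) genmxE.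
    by rewrite -hom_f // submxMl.
  by rewrite -mxrank_eq0 genmxE mxrank_eq0.
by apply: (MxReprSim (B := f)) => //; rewrite -[LHS](eqP free_f) (eqP full_f).
Qed.

(** Averaging over G, up to the factor |G|, turns any matrix into an
intertwiner. *)
Definition schur_avg m n (rS : mx_representation C G m)
    (rT : mx_representation C G n) (E : 'M[C]_(m, n)) :=
  \sum_(g in G) rS (g^-1)%g *m E *m rT g.

Lemma schur_avg_intertwiner m n (rS : mx_representation C G m)
    (rT : mx_representation C G n) (E : 'M_(m, n)) :
  {in G, forall x, rS x *m schur_avg rS rT E = schur_avg rS rT E *m rT x}.
Proof.
move=> x Gx; rewrite mulmx_sumr mulmx_suml (reindex_inj (mulIg x)) /=.
apply: eq_big => g; rewrite ?groupMr // => Gg.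
rewrite invMg !repr_mxM ?groupV // !mulmxA -repr_mxM ?groupV // mulgV.
by rewrite repr_mx1 mul1mx.
Qed.

(** The product of the diagonal entries S i i and T j j is the entry (i, j) of
S *m delta_mx i j *m T. *)
Lemma sum_mxtraceV m n (rS : mx_representation C G m)
    (rT : mx_representation C G n) :
  \sum_(g in G) \tr (rS (g^-1)%g) * \tr (rT g) =
    \sum_i \sum_j schur_avg rS rT (delta_mx i j) i j.
Proof.
transitivity (\sum_(g in G) \sum_i \sum_j rS (g^-1)%g i i * rT g j j).
  by apply: eq_bigr => g _; rewrite big_distrlr.
rewrite exchange_big; apply: eq_bigr => i _.
rewrite exchange_big; apply: eq_bigr => j _.
rewrite summxE; apply: eq_bigr => g _.
rewrite -(mul_delta_mx (0 : 'I_1)) mulmxA -colE -mulmxA -rowE mxE.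
by rewrite big_ord1 !mxE.
Qed.

Lemma mxtrace_orthogonal m n (rS : mx_representation C G m)
    (rT : mx_representation C G n) :
    mx_irreducible rS -> mx_irreducible rT -> ~ mx_rsim rS rT ->
  \sum_(g in G) \tr (rS (g^-1)%g) * \tr (rT g) = 0.
Proof.
move=> irrS irrT not_sim; rewrite sum_mxtraceV big1 // => i _; rewrite big1 // => j _.
have [-> | avg_neq0] := eqVneq (schur_avg rS rT (delta_mx i j)) 0; first by rewrite mxE.
case: not_sim; apply: intertwiner_irr_rsim avg_neq0 => //.
exact: schur_avg_intertwiner.
Qed.

(** Over a closed field the average of delta_mx i j is a scalar matrix; its trace
is |G| times that of delta_mx i j, which determines the scalar. *)
Lemma mxtrace_norm n (rS : mx_representation C G n) :
    mx_irreducible rS ->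
  \sum_(g in G) \tr (rS (g^-1)%g) * \tr (rS g) = #|G|%:R.
Proof.
move=> irrS; have [n_gt0 _] := (mx_irrP rS).1 irrS; rewrite sum_mxtraceV.
have avgE i j : schur_avg rS rS (delta_mx i j) = (#|G|%:R * (i == j)%:R / n%:R)%:M.
  have /is_scalar_mxP[a avg_a] : is_scalar_mx (schur_avg rS rS (delta_mx i j)).
    apply: mx_abs_irr_cent_scalar (group_closure_closed_field irrS) _ _.
    by apply/centgmxP=> x Gx; rewrite schur_avg_intertwiner.
  rewrite avg_a; congr (_%:M); have := congr1 mxtrace avg_a.
  rewrite mxtrace_scalar raddf_sum (eq_bigr (fun=> (i == j)%:R)) => [|g Gg].
    rewrite sumr_const => tr_a; apply: (canRL (mulfK _)).
      by rewrite pnatr_eq0 -lt0n.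
    by rewrite mulr_natl tr_a mulr_natr.
  rewrite /= mxtrace_mulC mulmxA -repr_mxM ?groupV // mulgV repr_mx1 mul1mx.
  by rewrite /mxtrace (bigD1 i) //= big1 ?mxE ?eqxx ?addr0 // => k /negPf nik; rewrite mxE nik.
rewrite (eq_bigr (fun=> #|G|%:R / n%:R)) => [|i _].
  by rewrite sumr_const card_ord -(mulr_natr (_ / _)) divfK // pnatr_eq0 -lt0n.
rewrite (bigD1 i) //= big1 ?avgE ?mxE ?eqxx ?mulr1 ?addr0 // => j /negPf nij.
by rewrite avgE mxE eq_sym nij.
Qed.

End SchurOrthogonality.

(** * Units of the representation ring of a rational group *)

Section RationalGroupUnits.

Variables (C : numClosedFieldType) (gT : finGroupType) (G : {group gT}).
Local Notation RG := (repr_ring C G).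

Lemma rr_charE (u : RG) g : g \in G ->
  rr_char u g = \tr ((repr u).1 g) - \tr ((repr u).2 g).
Proof. by move=> Gg; rewrite !ffunE Gg !mulr1n. Qed.

Lemma rr_charJ (u : RG) : {in G &, forall g h, rr_char u (g ^ h)%g = rr_char u g}.
Proof. by move=> g h Gg Gh; rewrite !rr_charE ?groupJ // !mxtrace_reprJ. Qed.

Lemma rr_charMz (u : RG) z g : rr_char (u *~ z) g = z%:~R * rr_char u g.
Proof.
have evalM (v : {ffun gT -> C}) m : (v *+ m) g = m%:R * v g.
  by rewrite ffunMnE mulr_natl.
rewrite raddfMz; case: z => m; first by rewrite evalM.
by rewrite NegzE mulrNz ffunE evalM rmorphN mulNr.
Qed.

(** This is |G| times the symmetric bilinear form of character theory, on the
diagonal, with g^-1 in place of complex conjugation. *)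
Definition rr_form (u : RG) := \sum_(g in G) rr_char u (g^-1)%g * rr_char u g.

Lemma rr_form_irr (iG : irrType C G) (c : iG -> int) :
  rr_form (\sum_i grepr_class (Representation (irr_repr i)) *~ c i) =
    #|G|%:R * (\sum_i `|c i| * `|c i|)%N%:R.
Proof.
have C'G : [pchar C]^'.-group%g G by apply/pgroupP=> p _; rewrite inE /= pchar_num.
set u := \sum_i _; have charE g : g \in G ->
    rr_char u g = \sum_i \tr (irr_repr i g) * (c i)%:~R.
  move=> Gg; rewrite raddf_sum sum_ffunE; apply: eq_bigr => i _.
  by rewrite rr_charMz rr_char_class ffunE Gg mulrC.
rewrite /rr_form (eq_bigr (fun g => \sum_i \sum_j
    (\tr (irr_repr i (g^-1)%g) * \tr (irr_repr j g)) * ((c i)%:~R * (c j)%:~R))); last first.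
  move=> g Gg; rewrite !charE ?groupV // big_distrlr; apply: eq_bigr => i _.
  by apply: eq_bigr => j _; rewrite mulrACA.
rewrite exchange_big natr_sum mulr_sumr; apply: eq_bigr => i _ /=.
rewrite exchange_big (bigD1 i) //= -mulr_suml mxtrace_norm; last exact: socle_irr.
rewrite big1 ?addr0 => [|j ne_ji].
  by rewrite -intrM -[c i * c i]gez0_abs ?sqr_ge0 // abszM.
rewrite -mulr_suml mxtrace_orthogonal ?mul0r //; try exact: socle_irr.
move/(irr_comp_rsim_pchar iG C'G); rewrite !irr_reprK_pchar // => eq_ij.
by rewrite eq_ij eqxx in ne_ji.
Qed.

Hypothesis ratG : rational_group G.

Lemma rr_charV (u : RG) g : g \in G -> rr_char u (g^-1)%g = rr_char u g.
Proof.
move=> Gg; rewrite invg_expg.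
by have [h Gh <-] := ratG Gg (coprimenP (order_gt0 g)); apply: rr_charJ.
Qed.

Lemma int_rr_char (u : RG) g : g \in G -> exists z : int, rr_char u g = z%:~R.
Proof.
move=> Gg; rewrite rr_charE //.
have [a ->] := int_mxtrace (mx_repr_of_repr (repr u).1) ratG Gg.
have [b ->] := int_mxtrace (mx_repr_of_repr (repr u).2) ratG Gg.
by exists (a - b); rewrite rmorphB.
Qed.

(** The values of u and of its inverse at g are integers with product 1. *)
Lemma unit_rr_char_sqr (u : RG) : u \is a GRing.unit ->
  {in G, forall g, rr_char u g * rr_char u g = 1}.
Proof.
move=> Uu g Gg; have := rr_charM (u^-1) u g.
rewrite -[repr_mul _ _]/(u^-1 * u) mulVr // rr_char1 Gg.
have [a ->] := int_rr_char u Gg; have [b ->] := int_rr_char u^-1 Gg.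
rewrite -intrM => /esym/(intr_inj (x2 := 1))/intUnitRing.unitzPl.
by rewrite qualifE => /orP[]/eqP->; rewrite -intrM.
Qed.

(** Since u(g^-1) u(g) = u(g)^2 = 1, rr_form u is |G|, so the coefficients of u on the
irreducible characters have square sum 1: u = c_i chi_i with c_i = 1 or -1.
Evaluating at 1 gives chi_i degree 1, so chi_i is multiplicative.  The factor
rr_char u 1 = c_i makes the identity independent of that sign. *)
Lemma unit_rr_char_mul (u : RG) : u \is a GRing.unit ->
  {in G &, forall g h, rr_char u (g * h)%g * rr_char u 1%g =
    rr_char u g * rr_char u h}.
Proof.
move=> Uu; pose iG : irrType C G := DecSocleType _.
have [c [def_u _]] := grepr_class_basis iG u.
have norm_u : rr_form u = #|G|%:R.
  rewrite /rr_form (eq_bigr (fun=> 1)) ?sumr_const // => g Gg.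
  by rewrite rr_charV // unit_rr_char_sqr.
move: (norm_u); rewrite {1}def_u rr_form_irr -{2}[#|G|%:R]mulr1.
move/(mulfI _); rewrite pnatr_eq0 -lt0n cardG_gt0 => /(_ isT)/eqP.
rewrite pnatr_eq1 => /sum_nat_eq1[i [_ ci1 cj0]].
have {}def_u : u = grepr_class (Representation (irr_repr i)) *~ c i.
  rewrite {1}def_u (bigD1 i) //= big1 ?addr0 // => j ne_ji.
  have /eqP := cj0 j ne_ji isT; rewrite muln_eq0 absz_eq0 orbb => /eqP->.
  by rewrite mulr0z.
have cc1 : (c i)%:~R * (c i)%:~R = 1 :> C.
  by rewrite -intrM -[c i * c i]gez0_abs ?sqr_ge0 // abszM ci1.
have charE g : g \in G -> rr_char u g = (c i)%:~R * \tr (irr_repr i g).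
  by move=> Gg; rewrite def_u rr_charMz rr_char_class ffunE Gg.
have lin_i : irr_degree i = 1%N.
  have := unit_rr_char_sqr Uu (group1 G); rewrite charE // repr_mx1 mxtrace1.
  rewrite mulrACA cc1 mul1r -natrM => /eqP.
  by rewrite pnatr_eq1 muln_eq1 => /andP[/eqP].
have tr_mul (n : nat) (rG : mx_representation C G n) : n = 1%N ->
    {in G &, forall g h, \tr (rG (g * h)%g) = \tr (rG g) * \tr (rG h)}.
  move=> n1; subst n => g h Gg Gh; rewrite repr_mxM // [rG g]mx11_scalar.
  by rewrite mul_scalar_mx mxtraceZ mxtrace_scalar.
move=> g h Gg Gh; rewrite !charE ?groupM // tr_mul // repr_mx1 mxtrace1.
have -> : (irr_degree i)%:R = 1 :> C by rewrite lin_i.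
by rewrite mulr1 mulrAC [RHS]mulrACA.
Qed.

End RationalGroupUnits.

(** * Symmetric groups *)

Lemma tperm_conj (T : finType) (x y a b : T) :
  x != y -> a != b -> exists h, (tperm x y ^ h)%g = tperm a b.
Proof.
(* The first factor sends x to a; the second fixes a and sends the image of y
   to b. *)
move=> ne_xy ne_ab; exists (tperm x a * tperm (tperm x a y) b)%g.
rewrite tpermJ !permM !tpermL; congr (tperm _ _).
apply: tpermD; last by rewrite eq_sym.
by rewrite -[X in _ != X](tpermL x a) (inj_eq perm_inj) eq_sym.
Qed.

Section SymmetricGroup.

Variables (C : numClosedFieldType) (T : finType) (x y : T).
Hypothesis ne_xy : x != y.
Local Notation RS := (repr_ring C [set: {perm T}]%G).
Local Notation t := (tperm x y).

(** Up to the sign of u at 1, the value of u at a product of transpositions is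
the product of its values at the factors, all equal to its value at t, which is
1 or -1: only the parity of the number of factors matters. *)
Lemma unit_rr_char_perm (u : RS) (g : {perm T}) : u \is a GRing.unit ->
  rr_char u g = if odd_perm g then rr_char u t else rr_char u 1%g.
Proof.
move=> Uu; have [s -> s_dpair] := prod_tpermP g; rewrite odd_perm_prod //.
have inG (h : {perm T}) : h \in [set: {perm T}]%G by rewrite inE.
have sq1 h : rr_char u h * rr_char u h = 1.
  by apply: unit_rr_char_sqr (inG h) => //; apply: symmetric_rational.
elim: s s_dpair => [|[a b] s IHs] /=; first by rewrite big_nil.
case/andP=> ne_ab /IHs{}IHs; rewrite big_cons /=.
have [h <-] := tperm_conj ne_xy ne_ab.
rewrite -[LHS]mulr1 -(sq1 1%g) mulrA unit_rr_char_mul //; last exact: symmetric_rational.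
rewrite rr_charJ // IHs; case: (odd _) => /=; first by rewrite sq1 mul1r.
by rewrite -mulrA sq1 mulr1.
Qed.

Lemma sign_mx_repr :
  mx_repr [set: {perm T}]%G (fun g : {perm T} => ((-1) ^+ g)%:M : 'M[C]_1).
Proof.
split=> [|g h _ _]; first by rewrite odd_perm1.
by rewrite odd_permM signr_addb scalar_mxM.
Qed.

Definition sign_class : RS := grepr_class (Representation (MxRepresentation sign_mx_repr)).

Lemma rr_char_sign g : rr_char sign_class g = (-1) ^+ g.
Proof. by rewrite rr_char_class ffunE inE mxtrace_scalar. Qed.

Lemma sign_class_unit : sign_class \is a GRing.unit.
Proof.
apply/unitrPr; exists sign_class; apply/rr_char_inj/ffunP=> g.
by rewrite rr_charM rr_char1 inE !rr_char_sign -expr2 sqrr_sign.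
Qed.

Lemma sqr1_pm (v : C) : v * v = 1 -> v = 1 \/ v = -1.
Proof. by rewrite -expr2 => /eqP; rewrite sqrf_eq1 => /orP[]/eqP; auto. Qed.

Lemma eqN11 : (-1 == 1 :> C) = false.
Proof. by rewrite eqNr oner_eq0. Qed.

(** The isomorphism from {1, -1} to Z/2; the values of interest are 1 and -1. *)
Definition sign_bit (z : C) : 'Z_2 := if z == 1 then 0 else 1.

Lemma sign_bitM z w : z * z = 1 -> w * w = 1 ->
  sign_bit (z * w) = sign_bit z + sign_bit w.
Proof.
move=> /sqr1_pm[]-> /sqr1_pm[]->;
  by rewrite /sign_bit ?mul1r ?mulr1 ?mulN1r ?opprK ?eqxx ?eqN11; apply/val_inj.
Qed.

Lemma sign_bit_inj z w :
  z * z = 1 -> w * w = 1 -> sign_bit z = sign_bit w -> z = w.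
Proof. by move=> /sqr1_pm[]-> /sqr1_pm[]->; rewrite /sign_bit ?eqxx ?eqN11. Qed.

Lemma sign_bitX (a : 'Z_2) : sign_bit ((-1) ^+ a) = a.
Proof.
by case: a => [[|[|//]] a_lt2]; rewrite /sign_bit ?expr1 ?expr0 ?eqxx ?eqN11; apply/val_inj.
Qed.

Local Notation US := (unit_group RS).

Definition unit_bits (u : US) : 'Z_2 * 'Z_2 :=
  (sign_bit (rr_char (ugval u) 1%g), sign_bit (rr_char (ugval u) t)).

Lemma unit_rr_char_sqr_perm (u : US) g :
  rr_char (ugval u) g * rr_char (ugval u) g = 1.
Proof.
by apply: (unit_rr_char_sqr (@symmetric_rational T) (valP u)); rewrite inE.
Qed.

Lemma unit_bits_morph : {morph unit_bits : u v / (u * v)%g}.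
Proof.
by move=> u v; rewrite /unit_bits /= !rr_charM !sign_bitM //; apply: unit_rr_char_sqr_perm.
Qed.

HB.instance Definition _ :=
  isMultiplicative.Build US ('Z_2 * 'Z_2)%type unit_bits unit_bits_morph.

Lemma unit_bits_inj : injective unit_bits.
Proof.
move=> u v [bits1 bitst]; apply/val_inj/rr_char_inj/ffunP=> g.
have eq1 := sign_bit_inj (unit_rr_char_sqr_perm u 1%g) (unit_rr_char_sqr_perm v 1%g) bits1.
have eqt := sign_bit_inj (unit_rr_char_sqr_perm u t) (unit_rr_char_sqr_perm v t) bitst.
by rewrite (unit_rr_char_perm g (valP u)) (unit_rr_char_perm g (valP v)) eq1 eqt.
Qed.

(** The unit with sign (-1)^p.1 at 1 and (-1)^p.2 at t: at t the sign character
turns (-1)^p.1 into (-1)^(p.1 + p.1 + p.2). *)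
Definition bits_unit_val (p : 'Z_2 * 'Z_2) : RS :=
  (-1) ^+ p.1 * sign_class ^+ (p.1 + p.2)%N.

Lemma bits_unit_subproof p : bits_unit_val p \is a GRing.unit.
Proof. by rewrite unitrM !unitrX ?unitrN1 ?sign_class_unit. Qed.

Definition bits_unit p : US := UnitGroup (bits_unit_subproof p).

Lemma rr_charX (u : RS) k g : rr_char (u ^+ k) g = rr_char u g ^+ k.
Proof.
elim: k => [|k IHk]; first by rewrite rr_char1 inE.
by rewrite !exprS rr_charM IHk.
Qed.

Lemma bits_unitK : cancel bits_unit unit_bits.
Proof.
have charN1 g : rr_char (-1 : RS) g = -1 by rewrite raddfN ffunE rr_char1 inE.
case=> a b; rewrite /unit_bits /= /bits_unit_val /= !rr_charM !rr_charX !charN1 !rr_char_sign.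
rewrite odd_perm1 odd_tperm ne_xy /= expr0 expr1 expr1n mulr1 exprD mulrA.
by rewrite -expr2 sqrr_sign mul1r !sign_bitX.
Qed.

Lemma unit_bits_bij : bijective unit_bits.
Proof. by exists bits_unit; [apply: inj_can_sym bits_unitK unit_bits_inj | apply: bits_unitK]. Qed.

End SymmetricGroup.

Theorem theorem9 (R : realType) :
  exists f : {multiplicative unit_group (repr_ring (complex R) [set: 'S_6]%G)
                              -> 'Z_2 * 'Z_2},
    bijective f.
Proof.
have ne01 : (ord0 : 'I_6) != ord_max by [].
exists (unit_bits ord0 ord_max).
exact: unit_bits_bij ne01.
Qed.
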